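(* There exist voting trees $\Omega_n$ on the candidate set $[n]$ (one for each number of candidates $n$) such that the performance guarantee of $\Omega_n$ is at least $(\sqrt{2}+o(1))\sqrt{n}$, where the $o(1)$ term tends to $0$ as $n\to\infty$.
   Context: Write $[n]=\{1,\dots,n\}$ and let $\mathcal{T}_n$ be the set of all tournaments on the vertex set $[n]$ (a tournament is an oriented complete graph: every pair of distinct vertices spans exactly one directed edge; $\overrightarrow{ij}\in T$ means that $i$ beats (defeats) $j$). The match between $i$ and $j$ on $T$ returns $i$ if $i=j$ or $\overrightarrow{ij}\in T$, and returns $j$ otherwise. A voting tree for $n$ agents is a finite (not necessarily complete) binary tree in which each node has either 0 or 2 children and each leaf is labeled by an element of $[n]$; several leaves may receive the same label. Given $T\in\mathcal{T}_n$, a voting tree $\Theta$ is evaluated by recursively labeling each internal node by the result of the match on $T$ between the labels of its two children; the label at the root is the output (the winner), denoted $\Theta(T)$. The performance guarantee of $\Theta$ is $\min_{T\in\mathcal{T}_n}\{\text{out-degree of }\Theta(T)\text{ in }T\}$. *)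

(* Defs.v *)
From HB Require Import structures.
From mathcomp Require Import all_boot.

Set Implicit Arguments.
Unset Strict Implicit.
Unset Printing Implicit Defensive.

(* Candidates are the elements of 'I_n, i.e. [n] shifted to start at 0;
   (i, j) \in T means that i beats j. *)
Definition is_tournament n (T : {set 'I_n * 'I_n}) : bool :=
  [forall i, (i, i) \notin T] &&
  [forall i, forall j, (i != j) ==> (((i, j) \in T) (+) ((j, i) \in T))].

Record tournament n := Tournament {
  edges :> {set 'I_n * 'I_n};
  edgesP : is_tournament edges }.

HB.instance Definition _ n := [isSub for @edges n].
HB.instance Definition _ n := [Countable of tournament n by <:].
HB.instance Definition _ n := [Finite of tournament n by <:].

Definition out_degree n (T : tournament n) (i : 'I_n) : nat :=
  #|[set j | (i, j) \in edges T]|.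

Definition match_result n (T : tournament n) (i j : 'I_n) : 'I_n :=
  if (i == j) || ((i, j) \in edges T) then i else j.

Inductive voting_tree n :=
  | Leaf of 'I_n
  | Node of voting_tree n & voting_tree n.

Fixpoint winner n (T : tournament n) (Theta : voting_tree n) : 'I_n :=
  match Theta with
  | Leaf i => i
  | Node l r => match_result T (winner T l) (winner T r)
  end.

(* Out-degrees are smaller than n and tournaments exist, so the initial value n
   plays no role: see performance_guarantee_le and performance_guarantee_attained. *)
Definition performance_guarantee n (Theta : voting_tree n) : nat :=
  \big[minn/n]_(T : tournament n) out_degree T (winner T Theta).

Lemma out_degree_lt n (T : tournament n) (i : 'I_n) : out_degree T i < n.
Proof.
have /andP[/forallP irr _] := edgesP T.
rewrite /out_degree -[X in _ < X]card_ord -cardsT; apply: proper_card.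
by apply/properP; split; [exact: subsetT | exists i; rewrite ?inE ?irr].
Qed.

Lemma transitive_is_tournament n :
  is_tournament [set e : 'I_n * 'I_n | e.1 < e.2].
Proof.
apply/andP; split; apply/forallP => i; first by rewrite inE /= ltnn.
apply/forallP => j; apply/implyP => neq_ij; rewrite !inE /=.
by case: ltngtP => // /val_inj eq_ij; rewrite eq_ij eqxx in neq_ij.
Qed.

Lemma performance_guarantee_le n (Theta : voting_tree n) (T : tournament n) :
  performance_guarantee Theta <= out_degree T (winner T Theta).
Proof.
rewrite /performance_guarantee; have := mem_index_enum T.
elim: (index_enum _) => // T' s IHs; rewrite inE big_cons geq_min.
by case/predU1P => [<-|/IHs->]; rewrite ?leqnn ?orbT.
Qed.

Lemma performance_guarantee_attained n (Theta : voting_tree n) :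
  exists T : tournament n,
    performance_guarantee Theta = out_degree T (winner T Theta).
Proof.
pose T0 := Tournament (transitive_is_tournament n).
have [T _ minT] := arg_minnP (fun T => out_degree T (winner T Theta))
                             (isT : xpredT T0).
exists T; apply/eqP; rewrite eqn_leq performance_guarantee_le /=.
rewrite /performance_guarantee; elim/big_ind: _ => [|x y lex ley|T' _].
- exact/ltnW/out_degree_lt.
- by rewrite leq_min lex ley.
- exact: minT.
Qed.

(* Main.v *)
Require Import Defs.
From mathcomp Require Import all_boot zify.

(** Fix [k = m + 1]; call a candidate good if it beats at least [k] others. The
    tree is built from two ideas.

    Climbing a chain. Start with any champion [v_0] and let [v_(t+1)] be some
    candidate that beats all of [v_0, ..., v_t], or [v_t] again if there is none
    ([championP]). If the chain has not stalled, a candidate that beats all of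
    [v_0, ..., v_m] is good. If it has, everybody who is not a champion loses to
    one, so when there are enough candidates some champion is good; but which one
    depends on the tournament, and the top of the chain may be a bad candidate
    whose only merit is to beat a good one.

    Descending the chain with thresholds. The tree [elect] locates a good
    champion. Working from [v_m] down to [v_0], each candidate set [S] of a
    prescribed size elects either a good champion met so far or a member of [S]
    that beats all the champions met so far. To include [v_l], where [l < m], let
    every subset of [S] of the previous size elect somebody, and let [v_l] meet
    all of these winners: [v_l] is replaced as soon as it loses to one of them.
    If [v_l] survives and is bad, every such subset contains a candidate that
    [v_l] beats and that beats [v_(l+1)], so [S] has more of these than the
    difference between its size and that of the subsets. None of them is among
    the [l] earlier champions, whom [v_l] beats too. Hence it is enough that the
    sizes grow by [k - l - 1] at this level: a surviving [v_l] then has [k]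
    victims and cannot be bad. This is [elect_winner].

    The sizes add up to [k + 1 + 'C(k, 2)], about [k ^ 2 / 2]. With that many
    candidates, the winner is a good champion or beats [v_0, ..., v_m], which
    are then distinct, and so is good again. Taking the largest admissible [k]
    gives [2 n <= (k + 2) ^ 2], that is, [k >= sqrt 2 * sqrt n - 2]. *)

Set Implicit Arguments.
Unset Strict Implicit.
Unset Printing Implicit Defensive.

(** * Matches and challenges *)

Definition beats n (T : tournament n) (i j : 'I_n) : bool := (i, j) \in edges T.

Lemma beats_irr n (T : tournament n) i : beats T i i = false.
Proof. by have /andP[/forallP/(_ i)/negbTE] := edgesP T. Qed.

Lemma beats_asym n (T : tournament n) i j : beats T i j -> beats T j i = false.
Proof.
move=> ij; have /andP[_ /forallP/(_ i)/forallP/(_ j)] := edgesP T.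
case: eqVneq => [eij|_] /=; first by rewrite eij beats_irr in ij.
by rewrite -!/(beats _ _ _) ij /= => /negbTE.
Qed.

Lemma beats_total n (T : tournament n) i j :
  i != j -> ~~ beats T i j -> beats T j i.
Proof.
move=> nij ij; have /andP[_ /forallP/(_ i)/forallP/(_ j)] := edgesP T.
by rewrite nij /= -!/(beats _ _ _) (negbTE ij).
Qed.

Lemma out_degree_ge n (T : tournament n) i (A : {set 'I_n}) :
  (forall j, j \in A -> beats T i j) -> #|A| <= out_degree T i.
Proof. by move=> iA; apply/subset_leq_card/subsetP => j /iA; rewrite inE. Qed.

(** Each challenger meets [w] before it meets the current winner, so a challenger
    that loses to [w] is represented by [w]: once [w] has lost, the current
    winner beats [w] and only somebody else who beats [w] can replace it. *)
Definition challenge n (w : voting_tree n) (s : seq (voting_tree n)) :=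
  foldl (@Node n) w [seq Node x w | x <- s].

Lemma challenge_winner n (T : tournament n) w (I : eqType)
    (f : I -> voting_tree n) s :
  let c := winner T (challenge w (map f s)) in
  (c = winner T w /\
     forall x, x \in s -> ~~ beats T (winner T (f x)) (winner T w)) \/
  (exists2 x, x \in s & c = winner T (f x) /\ beats T c (winner T w)).
Proof.
rewrite /challenge -map_comp /=.
elim/last_ind: s => [|s x IHs] /=; first by left.
rewrite map_rcons foldl_rcons /= /match_result.
set v := winner T w in IHs *; set c := winner T _ in IHs *.
rewrite -!/(beats _ _ _).
case bx: (beats T (winner T (f x)) v); last first.
  have -> : (if (winner T (f x) == v) || false then winner T (f x) else v) = v.
    by case: eqP.
  case: IHs => [[cv nb]|[y ys [cy bc]]].
    left; rewrite cv eqxx; split=> // y.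
    by rewrite mem_rcons inE => /orP[/eqP->|/nb //]; rewrite bx.
  right; exists y; first by rewrite mem_rcons inE ys orbT.
  by rewrite bc orbT.
rewrite orbT; right.
case: ifP => [cb|_]; last by exists x; rewrite ?mem_rcons ?mem_head.
case: IHs => [[cv _]|[y ys [cy bc]]].
  move: cb; rewrite cv (beats_asym bx) orbF => /eqP vx.
  by rewrite -vx beats_irr in bx.
by exists y => //; rewrite mem_rcons inE ys orbT.
Qed.

(** * The chain of champions *)

(** The second component keeps, for each candidate, its match against the
    champions in order of appearance; a champion never beats a later one, so a
    candidate that does not beat all of them is replaced by the last one. *)
Fixpoint round n (t : nat) : voting_tree n.+1 * ('I_n.+1 -> voting_tree n.+1) :=
  if t is t'.+1 then
    let: (w, f) := round n t' in
    (challenge w (map f (enum 'I_n.+1)), fun i => Node (f i) w)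
  else (Leaf ord0, @Leaf n.+1).

Definition champion n t := (round n t).1.
Definition contender n t := (round n t).2.

Lemma championS n t :
  champion n t.+1 =
    challenge (champion n t) (map (@contender n t) (enum 'I_n.+1)).
Proof. by rewrite /champion /contender /=; case: round. Qed.

Lemma contenderS n t (i : 'I_n.+1) :
  contender t.+1 i = Node (contender t i) (champion n t).
Proof. by rewrite /champion /contender /=; case: round. Qed.

Definition dominates n (T : tournament n) (v : nat -> 'I_n) r i :=
  forall s, s < r -> beats T i (v s).

(** A contender that has lost is represented by a label that does not beat
    [v t], so the challengers that defeat [v t] are exactly the candidates
    dominating the whole chain. *)
Lemma champion_step n (T : tournament n.+1) t :
  let v s := winner T (champion n s) in
  (forall i : 'I_n.+1,
      (winner T (contender t i) = i /\ dominates T v t i) \/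
      (~ dominates T v t i /\ ~~ beats T (winner T (contender t i)) (v t))) ->
  dominates T v t.+1 (v t.+1) \/
  (v t.+1 = v t /\ forall i, ~ dominates T v t.+1 i).
Proof.
move=> v cont.
have := challenge_winner T (champion n t) (@contender n t) (enum 'I_n.+1).
rewrite -championS /= -!/(v _) => -[[vE nb]|[x _ [vE bv]]].
  right; split=> [|i di]; first by [].
  have := nb i; rewrite mem_enum => /(_ isT).
  case: (cont i) => [[-> _]|[[]]]; first by rewrite di.
  by move=> s st; apply: di; apply: ltnW.
left=> s; case: (cont x) => [[xE dx]|[_]]; last by rewrite -vE bv.
by rewrite ltnS leq_eqVlt => /orP[/eqP->//|/dx]; rewrite vE xE.
Qed.

Lemma contenderP n (T : tournament n.+1) t (i : 'I_n.+1) :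
  let v s := winner T (champion n s) in
  (winner T (contender t i) = i /\ dominates T v t i) \/
  (~ dominates T v t i /\ ~~ beats T (winner T (contender t i)) (v t)).
Proof.
move=> v; elim: t i => [|t IHt] i; first by left.
have nb: ~~ beats T (v t) (v t.+1).
  case: (champion_step IHt) => [/(_ t (ltnSn t))/beats_asym->//|[vE _]].
  by rewrite [v t.+1]vE beats_irr.
rewrite contenderS /= /match_result -/(v t) -/(beats _ _ _).
case: (IHt i) => [[-> di]|[ndi nbi]].
  case bi: (beats T i (v t)).
    left; rewrite orbT; split=> // s.
    by rewrite ltnS leq_eqVlt => /orP[/eqP->|/di].
  right; split=> [/(_ t (ltnSn t))|]; first by rewrite bi.
  by case: eqP => [->|].
right; split=> [d|]; first by apply: ndi => s st; apply: d; apply: ltnW.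
by case: eqP => [->|_] //=; rewrite (negbTE nbi).
Qed.

(** The alternative is what makes a stalled chain useful: it stalls only when
    nobody dominates it. *)
Lemma championP n (T : tournament n.+1) t :
  let v s := winner T (champion n s) in
  dominates T v t.+1 (v t.+1) \/
  (v t.+1 = v t /\ forall i, ~ dominates T v t.+1 i).
Proof. by apply: champion_step => i; apply: contenderP. Qed.

Lemma champion_later n (T : tournament n.+1) s t : s <= t ->
  let v s := winner T (champion n s) in v t = v s \/ beats T (v t) (v s).
Proof.
move=> st v; elim: t st => [|t IHt]; first by rewrite leqn0 => /eqP->; left.
rewrite leq_eqVlt => /orP[/eqP->|st]; first by left.
case: (championP T t) => [d|[vE _]]; first by right; apply: d.
by rewrite /v vE; apply: IHt.
Qed.

(** A repetition would mean that the chain stalled before [t], leaving no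
    candidate able to dominate its first [t] members. *)
Lemma champion_inj n (T : tournament n.+1) t i :
  let v s := winner T (champion n s) in dominates T v t i ->
  {in gtn t &, injective v}.
Proof.
move=> v di.
suff lt r s : r < s < t -> v r <> v s.
  move=> r s rt st vrs; apply/eqP; case: ltngtP => // rs.
    by case: (lt r s); rewrite ?rs.
  by case: (lt s r); rewrite ?rs.
case: s => [|s]; first by rewrite ltn0.
move=> /andP[rs st] vrs; case: (championP T s) => [/(_ r rs)|[_ /(_ i)[]]].
  by rewrite -!/(v _) vrs beats_irr.
by move=> r' r's; apply: di; apply: leq_trans st; apply: ltnW.
Qed.

(** * Finding a good champion in the chain *)

(** The number of candidates that [elect m q] needs. The top level takes
    [m + 2], since a champion that beats all of them but possibly itself has
    degree above [m]; level [q] adds [q] more. *)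
Definition pool m q := m.+2 + 'C(q.+1, 2).

(** At level [q] the champions [m - q, ..., m] are taken into account. *)
Fixpoint elect n m q (S : {set 'I_n.+1}) : voting_tree n.+1 :=
  challenge (champion n (m - q))
    (if q is q'.+1 then
       map (elect m q')
         (enum [set S' : {set 'I_n.+1} |
                  (S' \subset S) && (#|S'| == pool m q')])
     else map (@Leaf n.+1) (enum S)).

(** The crucial case is a bad champion [v l] that survives all its challengers.
    These cannot be good champions of higher index, which would beat [v l] or
    equal it; so every subset contributes a candidate of the set [X] below, those
    beaten by [v l] but beating [v l.+1]. A set meeting all subsets of size
    [pool m q] of a set of size [pool m q.+1] has at least [q + 2] elements, and
    [v l] also beats the [l = m - q - 1] earlier champions, which lie outside
    [X] because [v l.+1] beats them: [m + 1] victims in all. *)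
Lemma elect_winner n (T : tournament n.+1) m q (S : {set 'I_n.+1}) :
  let v s := winner T (champion n s) in
  let c := winner T (elect m q S) in
  q <= m -> #|S| = pool m q ->
  (m < out_degree T c /\ exists2 s, m - q <= s & c = v s) \/
  (c \in S /\ forall s, m - q <= s <= m -> beats T c (v s)).
Proof.
move=> v; elim: q S => [|q IHq] S c qm cS.
  have := challenge_winner T (champion n m) (@Leaf n.+1) (enum S).
  have -> : challenge (champion n m) (map (@Leaf n.+1) (enum S)) = elect m 0 S.
    by rewrite /= subn0.
  rewrite -/c -/(v m) => -[[cE nb]|[x xS [cE bc]]]; last first.
    right; split=> [|s]; first by rewrite cE -mem_enum.
    by rewrite subn0 -eqn_leq => /eqP<-.
  left; split; last by exists m; rewrite ?subn0.
  apply: leq_trans (out_degree_ge (A := S :\ c) _).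
    have := cardsD1 c S; rewrite cS /pool bin_small // addn0.
    by case: (c \in S); rewrite ?add0n ?add1n; [case=> <- | move=> <-].
  move=> j /setD1P[jc jS]; rewrite cE in jc *; apply: beats_total => //.
  by apply: nb; rewrite mem_enum.
set ss := enum [set S' : {set 'I_n.+1} | (S' \subset S) && (#|S'| == pool m q)].
have ssP S' : (S' \in ss) = (S' \subset S) && (#|S'| == pool m q).
  by rewrite mem_enum inE.
set l := m - q.+1.
have lS : m - q = l.+1 by rewrite /l; lia.
have := challenge_winner T (champion n l) (elect m q) ss.
rewrite -[challenge _ _]/(elect m q.+1 S) -/c -/(v l).
move=> -[[cE nb]|[S' S's [cE bc]]]; last first.
  move: S's; rewrite ssP => /andP[S'S /eqP cS'].
  case: (IHq S' (ltnW qm) cS'); rewrite -cE => -[].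
    move=> good [s ls vs]; left; split=> //; exists s => //.
    by apply: leq_trans ls; rewrite lS.
  move=> cin call; right; split=> [|s]; first exact: (subsetP S'S).
  rewrite leq_eqVlt => /andP[/orP[/eqP<- //|ls] sm].
  by apply: call; rewrite lS ls.
have [good|bad] := ltnP m (out_degree T (v l)).
  by left; split; [rewrite cE | exists l].
(* From here on v l survives although it is bad; X gives it too many victims. *)
exfalso.
pose X := [set i in S | beats T (v l) i & beats T i (v l.+1)].
have meetX S' : S' \in ss -> exists2 x, x \in S' & x \in X.
  move=> S's; have nbc := nb _ S's.
  move: S's; rewrite ssP => /andP[S'S /eqP cS'].
  case: (IHq S' (ltnW qm) cS') => -[].
    move=> good [s ls vs]; exfalso.
    have ls' : l <= s by rewrite lS in ls; apply: ltnW.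
    move: good nbc; rewrite vs => good.
    case: (champion_later T ls') => [|->//].
    by rewrite -!/(v _) => vE; move: good; rewrite vE ltnNge bad.
  set x := winner T _ in nbc * => xS' call.
  have xl1 : beats T x (v l.+1) by apply: call; rewrite lS leqnn; lia.
  exists x => //; rewrite inE (subsetP S'S) //= xl1 andbT.
  apply: beats_total => //; apply/eqP => xE.
  case: (champion_later T (leqnSn l)) => [|]; rewrite -!/(v _) => E.
    by move: xl1; rewrite E xE beats_irr.
  by move: (beats_asym E); rewrite -xE xl1.
have cX : q.+1 < #|X|.
  rewrite ltnNge; apply/negP => cX.
  have: pool m q <= #|S :\: X|.
    rewrite cardsD (_ : S :&: X = X); last first.
      by apply/setIidPr/subsetP => i; rewrite inE => /andP[].
    by rewrite cS /pool [in 'C(q.+2, 2)]binS bin1; lia.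
  rewrite -bin_gt0 -cards_draws => /card_gt0P[S'].
  rewrite inE => /andP[S'D cS'].
  have [|x xS' xX] := meetX S'.
    by rewrite ssP cS' (subset_trans S'D) ?subsetDl.
  by have := subsetP S'D _ xS'; rewrite inE xX.
(* A member of X beats v l.+1 and loses to v l, so v l.+1 is not v l: the chain
   has not stalled yet and its members up to v l.+1 are distinct. *)
have [z zX] : exists z, z \in X by apply/card_gt0P; lia.
move: zX; rewrite inE => /and3P[_ lz zl1].
have dl : dominates T v l.+1 (v l.+1).
  case: (championP T l) => // -[vE _].
  by move: zl1; rewrite [v l.+1]vE (beats_asym lz).
have injv := champion_inj dl.
pose P := [set v s | s : 'I_l].
have cP : #|P| = l.
  rewrite card_in_imset ?card_ord // => s t _ _ /injv E.
  by apply/val_inj/E; rewrite !inE ltnS ltnW.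
have : #|P :|: X| <= out_degree T (v l).
  apply: out_degree_ge => j; rewrite inE => /orP[/imsetP[s _ ->]|]; last first.
    by rewrite inE => /and3P[].
  have [/injv E|//] := champion_later T (ltnW (ltn_ord s)).
  have {}E : l = s by apply: E; rewrite inE /= ltnS // ltnW.
  by have := ltn_ord s; rewrite -E ltnn.
have -> : #|P :|: X| = l + #|X|.
  rewrite cardsU cP (_ : P :&: X = set0) ?cards0 ?subn0 //.
  apply/setP => j; rewrite in_set0; apply/setIP => -[/imsetP[s _ ->]].
  rewrite inE => /and3P[_ _ b].
  by have := beats_asym (dl s (ltnW (ltn_ord s))); rewrite b.
by move: bad cX; rewrite /l; lia.
Qed.

Lemma pool_guarantee n m : pool m m <= n.+1 ->
  exists Theta : voting_tree n.+1, m < performance_guarantee Theta.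
Proof.
move=> mn.
have [S cS] : exists S : {set 'I_n.+1}, #|S| = pool m m.
  have : 0 < 'C(#|[set: 'I_n.+1]|, pool m m) by rewrite bin_gt0 cardsT card_ord.
  rewrite -cards_draws => /card_gt0P[S].
  by rewrite inE => /andP[_ /eqP]; exists S.
exists (elect m m S).
have [T ->] := performance_guarantee_attained (elect m m S).
have [[]//|[_]] := elect_winner T (leqnn m) cS.
set c := winner T _; rewrite subnn /= => dc.
have {}dc : dominates T (fun s => winner T (champion n s)) m.+1 c.
  by move=> s sm; apply: dc.
pose P := [set winner T (champion n s) | s : 'I_m.+1].
have <- : #|P| = m.+1.
  rewrite card_in_imset ?card_ord // => s t _ _ /(champion_inj dc) E.
  by apply/val_inj/E; rewrite inE /=.
by apply: out_degree_ge => j /imsetP[s _ ->]; apply: dc.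
Qed.

(** The bound is that of the largest [k] with [k + 1 + 'C(k, 2) <= n + 1]; the
    failure of [k + 1] reads [2 (n + 1) < k ^ 2 + 3 k + 4]. *)
Lemma exists_sqrt_guarantee n : exists (Theta : voting_tree n.+1) (k : nat),
  k <= performance_guarantee Theta /\ 2 * n.+1 <= (k + 2) ^ 2.
Proof.
pose fits k := k.+1 + 'C(k, 2) <= n.+1.
have fits0 : exists k, fits k by exists 0.
have fitsn k : fits k -> k <= n by rewrite /fits; lia.
case: (ex_maxnP fits0 fitsn) => k fk kmax.
have nfk : ~~ fits k.+1 by apply/negP => /kmax; rewrite ltnn.
have bnd : 2 * n.+1 <= (k + 2) ^ 2.
  move: nfk; rewrite /fits -ltnNge.
  by have := mul_bin_diag k.+1 1; rewrite bin1 /=; nia.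
case: k fk {kmax nfk} bnd => [|m] fk bnd.
  by exists (Leaf ord0), 0.
by have [Theta mT] := pool_guarantee fk; exists Theta, m.+1.
Qed.

(** * The asymptotic form *)

From mathcomp Require Import all_order all_algebra.
From mathcomp Require Import all_classical all_reals all_analysis.
Import Order.TTheory GRing.Theory Num.Theory.
Import numFieldNormedType.Exports.
Local Open Scope classical_set_scope.
Local Open Scope ring_scope.

Lemma cvg_inv_sqrt (R : realType) :
  (fun n : nat => - (2 / Num.sqrt (n%:R : R))) @ \oo --> (0 : R).
Proof.
have inv0 : (fun n : nat => (n%:R : R)^-1) @ \oo --> (0 : R).
  apply/gtr0_cvgV0; last exact: cvgr_idn.
  by exists 1%N => // n /= n0; rewrite ltr0n.
have : (fun n : nat => - (2 * Num.sqrt (n%:R : R)^-1)) @ \oo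
         --> - (2 * Num.sqrt (0 : R)).
  apply: cvgN; apply: cvgMr; apply: (cvg_comp _ _ inv0).
  exact: sqrt_continuous.
rewrite sqrtr0 mulr0 oppr0; apply: cvg_trans; apply: near_eq_cvg.
by near=> n; rewrite sqrtrV.
Unshelve. all: by end_near.
Qed.

Theorem theorem1p1 (R : realType) :
  exists (Omega : forall n : nat, voting_tree n.+1) (eps : nat -> R),
    eps @ \oo --> (0 : R) /\
    forall n : nat,
      (Num.sqrt 2 + eps n.+1) * Num.sqrt (n.+1%:R : R)
        <= (performance_guarantee (Omega n))%:R.
Proof.
have exT n : {Theta : voting_tree n.+1 | exists k : nat,
    (k <= performance_guarantee Theta)%N /\ (2 * n.+1 <= (k + 2) ^ 2)%N}.
  exact: cid (exists_sqrt_guarantee n).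
(* The bound sqrt (2 n) <= k + 2 leaves an error of 2, that is, 2 / sqrt n after
   division by sqrt n. *)
exists (fun n => sval (exT n)), (fun n => - (2 / Num.sqrt (n%:R : R))).
split=> [|n]; first exact: cvg_inv_sqrt.
have [k [kPG nk]] := svalP (exT n).
have s0 : Num.sqrt (n.+1%:R : R) != 0 by rewrite gt_eqF // sqrtr_gt0 ltr0n.
rewrite mulrBl divfK // -sqrtrM // -natrM lerBlDr.
apply: le_trans (_ : (k + 2)%:R <= _); last by rewrite natrD lerD2r ler_nat.
have -> : ((k + 2)%:R : R) = Num.sqrt ((k + 2) ^ 2)%:R.
  by rewrite natrX sqrtr_sqr ger0_norm.
by rewrite ler_wsqrtr // ler_nat.
Qed.
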